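(* Let $H$ be a complex Hilbert space, and let $\{f_k\}_{k=1}^\infty$ and $\{g_k\}_{k=1}^\infty$ be frames for $H$ that are not Riesz bases for $H$. Then the cross-Gram operator $G$ associated to $\{\langle f_k,g_j\rangle\}_{j,k=1}^\infty$ is not invertible on $\ell^2(\mathbb{N})$.
   Context: Inner products are linear in the first argument. A sequence $\{f_k\}_{k=1}^\infty\subset H$ is a frame for $H$ if there are constants $A,B>0$ with $A\|f\|^2\le\sum_{k=1}^\infty|\langle f,f_k\rangle|^2\le B\|f\|^2$ for all $f\in H$. A Riesz basis for $H$ is a family of the form $\{Ue_k\}_{k=1}^\infty$, where $\{e_k\}_{k=1}^\infty$ is an orthonormal basis for $H$ and $U:H\to H$ is a bounded bijective linear operator. The cross-Gram operator associated to $\{\langle f_k,g_j\rangle\}_{j,k=1}^\infty$ is the bounded operator $G:\ell^2(\mathbb{N})\to\ell^2(\mathbb{N})$, $G\{c_k\}_{k=1}^\infty=\left\{\left\langle\sum_{\ell=1}^\infty c_\ell f_\ell,g_j\right\rangle\right\}_{j=1}^\infty$, whose matrix has $(j,k)$ entry $\langle f_k,g_j\rangle$. Invertible means bijective with bounded inverse. *)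

(* Defs.v *)
From HB Require Import structures.
From mathcomp Require Import all_boot all_order all_algebra.
From mathcomp Require Import complex.
From mathcomp Require Import all_classical all_reals all_analysis.
Import Order.TTheory GRing.Theory Num.Theory.
Import numFieldNormedType.Exports.

Set Implicit Arguments.
Unset Strict Implicit.
Unset Printing Implicit Defensive.

Local Open Scope classical_set_scope.
Local Open Scope ring_scope.
Local Open Scope complex_scope.

(* Sequences (f_k), k >= 1, are indexed by nat, starting from 0. *)

(* Over the scalar field R[i] the library norm takes values in R[i], where they
   are nonnegative reals; [rnorm] reads them in R, for scalars and for vectors. *)
Definition rnorm (R : realType) (V : normedZmodType R[i]) (x : V) : R :=
  complex.Re `|x|.

Section hilbert.
Variables (R : realType) (H : completeNormedModType R[i]).
Variable ip : H -> H -> R[i].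

(* The series of nonnegative terms is taken in the extended reals, so that the
   upper bound contains its convergence. *)
Definition frame (f : nat -> H) : Prop :=
  exists A B : R, [/\ 0 < A, 0 < B & forall x : H,
    ((A * rnorm x ^+ 2)%:E <= \sum_(0 <= k <oo) (rnorm (ip x (f k)) ^+ 2)%:E)%E /\
    (\sum_(0 <= k <oo) (rnorm (ip x (f k)) ^+ 2)%:E <= (B * rnorm x ^+ 2)%:E)%E].

Definition lin_span (e : nat -> H) : set H :=
  [set x | exists n (c : nat -> R[i]), x = \sum_(k < n) c k *: e k].

Definition orthonormal_basis (e : nat -> H) : Prop :=
  (forall j k, ip (e j) (e k) = (j == k)%:R) /\ dense (lin_span e).

Definition bounded_linear_map (U : {linear H -> H}) : Prop :=
  exists M : R, forall x : H, rnorm (U x) <= M * rnorm x.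

Definition riesz_basis (f : nat -> H) : Prop :=
  exists (e : nat -> H) (U : {linear H -> H}),
    [/\ orthonormal_basis e, bounded_linear_map U, bijective U &
        forall k, f k = U (e k)].

(* The operator c |-> (< sum_l c_l f_l, g_j >)_j; the sum is the limit in H of
   the partial sums. *)
Definition cross_gram (f g : nat -> H) (c : nat -> R[i]) : nat -> R[i] :=
  fun j => ip (limn (series (fun l => c l *: f l))) (g j).

End hilbert.

Section l2.
Variable R : realType.

Definition l2_sqnorm (c : nat -> R[i]) : \bar R :=
  (\sum_(0 <= k <oo) (rnorm (c k) ^+ 2)%:E)%E.

Definition l2 : set (nat -> R[i]) := [set c | (l2_sqnorm c < +oo)%E].

(* Meaningful on [l2] only. *)
Definition l2_norm (c : nat -> R[i]) : R := Num.sqrt (fine (l2_sqnorm c)).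

(* [T] restricts to a bijection of [l2] onto itself whose inverse [S] is bounded. *)
Definition l2_invertible (T : (nat -> R[i]) -> (nat -> R[i])) : Prop :=
  set_fun l2 l2 T /\
  exists S : (nat -> R[i]) -> (nat -> R[i]),
    [/\ set_fun l2 l2 S,
        (forall c, l2 c -> S (T c) = c),
        (forall c, l2 c -> T (S c) = c) &
        exists M : R, forall c, l2 c -> l2_norm (S c) <= M * l2_norm c].

End l2.

(* Main.v *)
(* Write T_f c = \sum_k c_k f_k for the synthesis operator, so that G c is the
   sequence of the <T_f c, g_j>. If G is bijective on l2 then f is already a
   Riesz basis. Indeed T_f is injective because G is; and for y in H the
   sequence (<y, g_j>)_j lies in l2, hence equals G c for some c, so that
   T_f c - y is orthogonal to every g_j and vanishes by the lower frame bound
   of g: T_f is onto. Injectivity makes f linearly independent, and Gram-Schmidt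
   turns f into an orthonormal sequence e; it is complete because the lower
   frame bound of f makes f complete. The operator U x = T_f (<x, e_k>)_k is
   then bounded, bijective and sends e_k to f_k. *)

Require Import Defs.
From HB Require Import structures.
From mathcomp Require Import all_boot all_order all_algebra.
From mathcomp Require Import complex.
From mathcomp Require Import all_classical all_reals all_analysis.
From mathcomp Require Import ring lra.
Import Order.TTheory GRing.Theory Num.Theory.
Import numFieldNormedType.Exports.

Set Implicit Arguments.
Unset Strict Implicit.
Unset Printing Implicit Defensive.

Local Open Scope classical_set_scope.
Local Open Scope ring_scope.
Local Open Scope complex_scope.

(** * Real-valued norms over complex scalars *)

Section rnorm_theory.
Variables (R : realType) (V : normedModType R[i]).
Implicit Type W : normedZmodType R[i].

Lemma rnormE W (x : W) : (rnorm x)%:C = `|x|.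
Proof. by rewrite /rnorm RRe_real // ger0_real. Qed.

Lemma rnorm_ge0 W (x : W) : 0 <= rnorm x.
Proof. by rewrite -(@ler0c R) rnormE. Qed.

Lemma rnorm0 W : rnorm (0 : W) = 0.
Proof. by rewrite /rnorm normr0. Qed.

Lemma rnorm_eq0 W (x : W) : (rnorm x == 0) = (x == 0).
Proof.
by rewrite -[RHS]normr_eq0 -rnormE; apply/idP/idP => [/eqP->|/eqP[->]].
Qed.

Lemma rnormD W (x y : W) : rnorm (x + y) <= rnorm x + rnorm y.
Proof. by rewrite -lecR rmorphD /= !rnormE ler_normD. Qed.

Lemma rnorm_sum W (I : Type) (r : seq I) (P : pred I) (F : I -> W) :
  rnorm (\sum_(i <- r | P i) F i) <= \sum_(i <- r | P i) rnorm (F i).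
Proof.
rewrite -lecR rnormE rmorph_sum /=.
apply: le_trans (ler_norm_sum _ _ _) _; apply: ler_sum => i _.
by rewrite rnormE.
Qed.

Lemma rnormM (a b : R[i]) : rnorm (a * b) = rnorm a * rnorm b.
Proof. by apply: complexI; rewrite rmorphM /= !rnormE normrM. Qed.

Lemma cvg_rnormP (s : nat -> V) (l : V) :
  s @ \oo --> l <->
  forall eps : R, 0 < eps -> \forall n \near \oo, rnorm (l - s n) < eps.
Proof.
split=> [/cvgrPdist_lt sl eps eps0|sl].
  have := sl eps%:C; rewrite ltcR => /(_ eps0).
  by apply: filterS => n; rewrite -rnormE ltcR.
apply/cvgrPdist_lt => eps eps0.
(* In the order of [R[i]] a positive element is real, so [eps] comes from [R]. *)
have epsE : (complex.Re eps)%:C = eps by rewrite RRe_real // gtr0_real.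
rewrite -epsE in eps0 *; rewrite ltcR in eps0.
by apply: filterS (sl _ eps0) => n; rewrite -rnormE ltcR.
Qed.

End rnorm_theory.

(** * Square-summable sequences through their partial sums *)

Section square_summable.
Variable R : realType.
Implicit Type c : nat -> R[i].

Lemma nneseries_le (u : nat -> R) (M : R) : (forall k, 0 <= u k) ->
  (\sum_(0 <= k <oo) (u k)%:E <= M%:E)%E <->
  forall n, \sum_(0 <= k < n) u k <= M.
Proof.
move=> u0; split=> [uM n|uM].
  rewrite -lee_fin -sumEFin; apply: le_trans uM.
  by apply: nneseries_lim_ge => k _ _; rewrite lee_fin.
apply: lime_le; first by apply: is_cvg_nneseries => k _ _; rewrite lee_fin.
by apply: nearW => n; rewrite sumEFin lee_fin.
Qed.

Lemma l2P c :
  l2 c <-> exists M : R, forall n, \sum_(0 <= k < n) rnorm (c k) ^+ 2 <= M.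
Proof.
have c0 k : 0 <= rnorm (c k) ^+ 2 by exact: sqr_ge0.
split=> [cfin|[M /(nneseries_le _ c0) cM]]; last exact: le_lt_trans cM (ltry _).
exists (fine (l2_sqnorm c)); apply/nneseries_le => //.
rewrite fineK // ge0_fin_numE //.
by apply: nneseries_ge0 => k _ _; rewrite lee_fin.
Qed.

Lemma l2_finite c n : (forall k, (n <= k)%N -> c k = 0) -> l2 c.
Proof.
move=> c0; apply/l2P; exists (\sum_(0 <= k < n) rnorm (c k) ^+ 2) => m.
have [mn|nm] := leqP m n.
  rewrite [leRHS](big_cat_nat (n := m)) //= lerDl sumr_ge0 // => k _.
  exact: sqr_ge0.
rewrite (big_cat_nat (n := n)) ?(ltnW nm) //= gerDl big_nat.
rewrite big1 // => k /andP[nk _].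
by rewrite c0 // rnorm0 expr0n.
Qed.

End square_summable.

(** * Bessel sequences and their synthesis operators *)

Section bessel_sequences.
Variables (R : realType) (H : completeNormedModType R[i]).
Variable ip : {dot H for (@conjc R)}.
Hypothesis ip_norm : forall x : H, `|x| ^+ 2 = ip x x.
Implicit Types (x y : H) (v e f : nat -> H) (c : nat -> R[i]).

(** Bounding finite sums instead of a series keeps the inequality in [R]. *)
Definition bessel v (B : R) :=
  forall x n, \sum_(0 <= k < n) rnorm (ip x (v k)) ^+ 2 <= B * rnorm x ^+ 2.

(** Meaningful when the series converges, as it does for a Bessel [v] and [c] in [l2]. *)
Definition synthesis v c : H := limn (series (fun k => c k *: v k)).

Lemma ipC x y : ip x y = (ip y x)^*.
Proof. by rewrite [LHS]hermC expr0 mul1r. Qed.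

Lemma rnorm_ipC x y : rnorm (ip x y) = rnorm (ip y x).
Proof. by rewrite ipC /rnorm normcJ. Qed.

Lemma ip_rnorm x : ip x x = (rnorm x ^+ 2)%:C.
Proof. by rewrite -ip_norm rmorphXn /= rnormE. Qed.

(* Pairing x = \sum c_k v_k with itself gives
   [|x|^2 <= \sum |c_k| |<x, v_k>|], and each summand is at most
   [B |c_k|^2 / 2 + |<x, v_k>|^2 / (2 B)]; the second part sums to at most
   [|x|^2 / 2]. *)
Lemma bessel_sum_le v B c m n : 0 < B -> bessel v B ->
  rnorm (\sum_(m <= k < n) c k *: v k) ^+ 2 <=
  B * \sum_(m <= k < n) rnorm (c k) ^+ 2.
Proof.
move=> B0 vB; set x := \sum_(m <= k < n) _.
have xE : ip x x = \sum_(m <= k < n) c k * ip (v k) x.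
  rewrite {1}/x linear_sumlz; apply: eq_bigr => k _.
  by rewrite linearZl_LR.
have x_le : rnorm x ^+ 2 <= \sum_(m <= k < n) rnorm (c k) * rnorm (ip x (v k)).
  have -> : rnorm x ^+ 2 = rnorm (ip x x).
    apply: complexI; rewrite -[LHS]ip_rnorm [RHS]rnormE ip_rnorm ger0_norm //.
    by rewrite ler0c sqr_ge0.
  rewrite xE; apply: le_trans (rnorm_sum _ _ _) _; apply: ler_sum => k _.
  by rewrite rnormM (rnorm_ipC x).
have v_le : \sum_(m <= k < n) rnorm (ip x (v k)) ^+ 2 <= B * rnorm x ^+ 2.
  apply: le_trans (vB x n); have [nm|mn] := leqP n m.
    by rewrite big_geq // sumr_ge0 // => k _; exact: sqr_ge0.
  rewrite [leRHS](big_cat_nat (n := m)) ?(ltnW mn) //= lerDr sumr_ge0 // => k _.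
  exact: sqr_ge0.
have /(le_trans x_le) : \sum_(m <= k < n) rnorm (c k) * rnorm (ip x (v k)) <=
    \sum_(m <= k < n) (B / 2 * rnorm (c k) ^+ 2
                       + (2 * B)^-1 * rnorm (ip x (v k)) ^+ 2).
  apply: ler_sum => k _; set a := rnorm (c k); set b := rnorm _.
  rewrite -subr_ge0.
  have -> : B / 2 * a ^+ 2 + (2 * B)^-1 * b ^+ 2 - a * b
            = (2 * B)^-1 * (B * a - b) ^+ 2 by field; rewrite gt_eqF.
  by rewrite mulr_ge0 ?sqr_ge0 // invr_ge0 mulr_ge0 // ltW.
rewrite big_split /= -!mulr_sumr => x_le2.
have : (2 * B)^-1 * \sum_(m <= k < n) rnorm (ip x (v k)) ^+ 2 <=
    rnorm x ^+ 2 / 2.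
  have -> : rnorm x ^+ 2 / 2 = (2 * B)^-1 * (B * rnorm x ^+ 2).
    by field; rewrite gt_eqF.
  by apply: ler_wpM2l v_le; rewrite invr_ge0 mulr_ge0 // ltW.
lra.
Qed.

(** The Cauchy criterion passes from the real series of the |c_k|^2 to the vector series, whose
    blocks [bessel_sum_le] controls. *)
Lemma bessel_cvg v B c : 0 < B -> bessel v B -> l2 c ->
  cvgn (series (fun k => c k *: v k)).
Proof.
move=> B0 vB /l2P[M cM]; apply/cauchy_cvgP/cauchy_seriesP => eps eps0.
have epsE : (complex.Re eps)%:C = eps by rewrite RRe_real // gtr0_real.
rewrite -epsE in eps0 *; rewrite ltcR in eps0.
set d := complex.Re eps in eps0 *.
(* The factor [B] of [bessel_sum_le] turns the threshold d^2 / B into d^2. *)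
have /cauchy_cvgP/cauchy_seriesP/(_ (d ^+ 2 / B)) :
    cvgn (series (fun k => rnorm (c k) ^+ 2)).
  apply: nondecreasing_is_cvgn; last by exists M => _ [n _ <-]; exact: cM.
  by apply: nondecreasing_series => k _ _; exact: sqr_ge0.
rewrite divr_gt0 ?exprn_gt0 // => /(_ isT); apply: filterS => -[m n] /= mn.
rewrite -rnormE ltcR -(ltr_pXn2r (n := 2)) ?nnegrE ?rnorm_ge0 ?(ltW eps0) //.
apply: le_lt_trans (bessel_sum_le _ _ _ B0 vB) _.
rewrite mulrC -ltr_pdivlMr //; apply: le_lt_trans mn.
by rewrite ler_norm.
Qed.

Lemma synthesis_cvg v B c : 0 < B -> bessel v B -> l2 c ->
  series (fun k => c k *: v k) @ \oo --> synthesis v c.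
Proof. by move=> B0 vB cl; exact: bessel_cvg B0 vB cl. Qed.

Lemma synthesis_bounded v B c M : 0 < B -> bessel v B ->
  (forall n, \sum_(0 <= k < n) rnorm (c k) ^+ 2 <= M) ->
  rnorm (synthesis v c) <= Num.sqrt (B * M).
Proof.
move=> B0 vB cM; have cl : l2 c by apply/l2P; exists M.
apply/ler_addgt0Pr => eps eps0.
have /cvg_rnormP/(_ _ eps0)[n _ /(_ n (leqnn n)) /= lt_eps] :=
  synthesis_cvg B0 vB cl.
rewrite -[X in rnorm X](subrK (series (fun k => c k *: v k) n)) addrC.
apply: le_trans (rnormD _ _) _; apply: lerD (ltW lt_eps).
rewrite -[leLHS]ger0_norm ?rnorm_ge0 // -sqrtr_sqr ler_wsqrtr //.
apply: le_trans (bessel_sum_le _ _ _ B0 vB) _.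
by rewrite ler_pM2l.
Qed.

Lemma synthesis_linear v B a c c' : 0 < B -> bessel v B -> l2 c -> l2 c' ->
  synthesis v (fun k => a * c k + c' k) = a *: synthesis v c + synthesis v c'.
Proof.
move=> B0 vB cl cl'; apply/cvg_lim => //.
have -> : series (fun k => (a * c k + c' k) *: v k) =
    (fun n => a *: series (fun k => c k *: v k) n +
              series (fun k => c' k *: v k) n).
  apply/funext => n; rewrite /series /= scaler_sumr -big_split /=.
  by apply: eq_bigr => k _; rewrite scalerDl scalerA.
apply: cvgD (synthesis_cvg B0 vB cl').
exact: cvgZl_tmp (synthesis_cvg B0 vB cl).
Qed.

Lemma analysis_l2 v B x : bessel v B -> l2 (fun k => ip x (v k)).
Proof. by move=> vB; apply/l2P; exists (B * rnorm x ^+ 2) => n; exact: vB. Qed.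

Lemma synthesis_finite v c n : (forall k, (n <= k)%N -> c k = 0) ->
  synthesis v c = \sum_(0 <= k < n) c k *: v k.
Proof.
move=> c0; apply/cvg_lim => //; apply: cvg_near_cst.
exists n => // m /= nm; rewrite /series /= (big_cat_nat (n := n)) //=.
rewrite [X in _ + X]big_nat [X in _ + X]big1 ?addr0 // => k /andP[nk _].
by rewrite c0 // scale0r.
Qed.

(** * Orthonormal sequences: Bessel's inequality and coefficients *)

Definition orthonormal_seq e := forall j k, ip (e j) (e k) = (j == k)%:R.

Lemma orthonormal_sum e c j n : orthonormal_seq e ->
  ip (\sum_(0 <= k < n) c k *: e k) (e j) = if (j < n)%N then c j else 0.
Proof.
move=> eo; rewrite linear_sumlz.
under eq_bigr do rewrite linearZl_LR /= eo mulr_natr mulrb.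
by rewrite -big_mkcond /= big_nat1_eq.
Qed.

(** For the projection p of x onto the first n vectors, <x, p> = <p, p> is the sum in question, and
    0 <= |x - p|^2 = |x|^2 - <x, p>. *)
Lemma orthonormal_bessel e : orthonormal_seq e -> bessel e 1.
Proof.
move=> eo x n; rewrite mul1r -lecR -ip_rnorm.
set p := \sum_(0 <= k < n) ip x (e k) *: e k.
have pE : ip x p = (\sum_(0 <= k < n) rnorm (ip x (e k)) ^+ 2)%:C.
  rewrite linear_sumr rmorph_sum; apply: eq_bigr => k _ /=.
  by rewrite linearZr_LR /= mulrC -sqr_normc rmorphXn /= rnormE.
have pp : ip p p = ip x p.
  rewrite {2}/p linear_sumr [in RHS]/p [RHS]linear_sumr !big_nat.
  apply: eq_bigr => k /andP[_ kn]; rewrite !linearZr_LR /=.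
  by rewrite orthonormal_sum // kn.
have : 0 <= ip (x - p) (x - p) by rewrite ip_rnorm ler0c sqr_ge0.
have px : ip p x = ip x p by rewrite ipC pE conjc_real.
by rewrite linearBr 2!linearBl /= pp px subrr subr0 subr_ge0 pE.
Qed.

(** Partial sums longer than j have j-th coefficient exactly [c j]. The coefficient passes to the
    limit because |<y, e_j>| <= |y|, a single term of Bessel's inequality. *)
Lemma orthonormal_synthesis e c j : orthonormal_seq e -> l2 c ->
  ip (synthesis e c) (e j) = c j.
Proof.
move=> eo cl; have eb := orthonormal_bessel eo.
apply/eqP; rewrite -subr_eq0 -rnorm_eq0 eq_le rnorm_ge0 andbT.
apply/ler_addgt0Pr => eps eps0; rewrite add0r.
have /cvg_rnormP/(_ _ eps0)[n _ nP] := synthesis_cvg ltr01 eb cl.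
(* The index must be past [n] for closeness to the limit and past [j] for the term [c j] to be in
   the sum. *)
have := nP (maxn n j.+1) (leq_maxl _ _); set s := series _ _ => /= /ltW.
apply: le_trans.
have -> : ip (synthesis e c) (e j) - c j = ip (synthesis e c - s) (e j).
  by rewrite linearBl /s /series /= orthonormal_sum // leq_maxr.
set y := _ - s; rewrite -(ler_pXn2r (n := 2)) ?nnegrE ?rnorm_ge0 //.
apply: le_trans (_ : 1 * rnorm y ^+ 2 <= _); last by rewrite mul1r.
apply: le_trans (eb y j.+1); rewrite big_nat_recr //= lerDr.
by apply: sumr_ge0 => k _; exact: sqr_ge0.
Qed.

(** * Spans of initial segments and linear independence *)

Definition partial_span v n : set H :=
  [set x | exists c, x = \sum_(0 <= k < n) c k *: v k].

Lemma partial_spanP v n a x y : partial_span v n x -> partial_span v n y ->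
  partial_span v n (a *: x + y).
Proof.
move=> [c ->] [d ->]; exists (fun k => a * c k + d k).
rewrite scaler_sumr -big_split /=; apply: eq_bigr => k _.
by rewrite scalerDl scalerA.
Qed.

Lemma partial_span_sum v n m (a : nat -> R[i]) (w : nat -> H) :
  (forall k, (k < m)%N -> partial_span v n (w k)) ->
  partial_span v n (\sum_(0 <= k < m) a k *: w k).
Proof.
elim: m => [|m IHm] vw.
  by exists (fun=> 0); rewrite big_geq // big1 // => k _; rewrite scale0r.
rewrite big_nat_recr //= addrC; apply: partial_spanP; first exact: vw.
by apply: IHm => k km; apply: vw; exact: ltnW.
Qed.

Lemma partial_span_nth v n k : (k < n)%N -> partial_span v n (v k).
Proof.
move=> kn; exists (fun j => (j == k)%:R).
under eq_bigr do rewrite scaler_nat mulrb.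
by rewrite -big_mkcond /= big_nat1_eq kn.
Qed.

Lemma partial_span_le v m n : (m <= n)%N ->
  partial_span v m `<=` partial_span v n.
Proof.
move=> mn _ [c ->]; apply: partial_span_sum => k km.
exact: partial_span_nth (leq_trans km mn).
Qed.

Definition linearly_independent v := forall n c,
  \sum_(0 <= k < n) c k *: v k = 0 -> forall k, (k < n)%N -> c k = 0.

Lemma linearly_independent_span v n : linearly_independent v ->
  ~ partial_span v n (v n).
Proof.
move=> vfree [c vn].
(* Coefficients of the nontrivial relation obtained by moving [v n] to the other side. *)
pose d k := if (k < n)%N then c k else -1.
suff /vfree/(_ n (ltnSn n))/eqP : \sum_(0 <= k < n.+1) d k *: v k = 0.
  by rewrite /d ltnn oppr_eq0 oner_eq0.
rewrite big_nat_recr //= {2}/d ltnn scaleN1r vn; apply/eqP; rewrite subr_eq0.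
by apply/eqP; apply: eq_big_nat => k /andP[_ kn]; rewrite /d kn.
Qed.

(** * Gram-Schmidt orthonormalization *)

Definition residual f (s : seq H) n := f n - \sum_(u <- s) ip (f n) u *: u.

(** Each new vector depends on all earlier ones, so the recursion carries the whole list. *)
Fixpoint gram_schmidt_seq f n : seq H :=
  if n is m.+1 then
    let s := gram_schmidt_seq f m in
    rcons s (`|residual f s m|^-1 *: residual f s m)
  else [::].

Definition gram_schmidt f n := last 0 (gram_schmidt_seq f n.+1).

Lemma gram_schmidt_seqE f n : gram_schmidt_seq f n = mkseq (gram_schmidt f) n.
Proof.
elim: n => // n IHn; rewrite mkseqS -IHn /gram_schmidt /=.
by rewrite last_rcons.
Qed.

Lemma gram_schmidtE f n :
  let h := f n -
    \sum_(0 <= k < n) ip (f n) (gram_schmidt f k) *: gram_schmidt f k in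
  gram_schmidt f n = `|h|^-1 *: h.
Proof.
rewrite /= {1}/gram_schmidt /= last_rcons /residual gram_schmidt_seqE big_map.
by rewrite /index_iota subn0.
Qed.

Section independent.
Variable f : nat -> H.
Hypothesis f_free : linearly_independent f.
Local Notation e := (gram_schmidt f).
Local Notation h n := (f n - \sum_(0 <= k < n) ip (f n) (e k) *: e k).

Lemma gram_schmidt_span n : partial_span f n.+1 (e n).
Proof.
elim/ltn_ind: n => n IHn; rewrite gram_schmidtE /=.
set a := `|_|^-1; rewrite scalerBr scaler_sumr.
rewrite -[a *: f n]addr0 -sumrN addrAC addr0; apply: partial_spanP.
  exact: partial_span_nth.
under eq_bigr do rewrite scalerA -scaleNr.
apply: partial_span_sum => k kn.
by apply: partial_span_le (IHn k kn); exact: ltnW.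
Qed.

(** Otherwise [f n] would lie in the span of the earlier [e k], hence of the earlier [f k], against
    independence. *)
Lemma residual_neq0 n : h n != 0.
Proof.
apply/eqP => /eqP; rewrite subr_eq0 => /eqP fn.
apply: (linearly_independent_span (n := n) f_free); rewrite fn.
apply: partial_span_sum => k kn.
by apply: partial_span_le (gram_schmidt_span k).
Qed.

Lemma gram_schmidt_decomp n : partial_span e n.+1 (f n).
Proof.
have fn : f n = `|h n| *: e n + \sum_(0 <= k < n) ip (f n) (e k) *: e k.
  by rewrite [in e n]gram_schmidtE /= scalerA divff ?scale1r ?subrK //
             normr_eq0 residual_neq0.
rewrite fn; apply: partial_spanP; first exact: partial_span_nth.
by apply: partial_span_sum => k kn; apply: partial_span_nth; exact: ltnW.
Qed.

Lemma gram_schmidt_orthonormal : orthonormal_seq e.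
Proof.
have e1 n : ip (e n) (e n) = 1.
  rewrite -ip_norm gram_schmidtE /= normrZ normfV normr_id mulVf ?expr1n //.
  by rewrite normr_eq0 residual_neq0.
have e0 n : forall k, (k < n)%N -> ip (e n) (e k) = 0.
  elim/ltn_ind: n => n IHn k kn.
  rewrite gram_schmidtE /= linearZl_LR /= linearBl linear_sumlz.
  set a := `|_|^-1; rewrite big_nat.
  (* Here j and k are both below n. The induction hypothesis covers the pairing with the larger
     index first, and conjugate symmetry the other order. *)
  under eq_bigr => j /andP[_ jn].
    rewrite linearZl_LR /= (_ : ip (e j) (e k) = (j == k)%:R); last first.
      have [->|jk] := eqVneq j k; first exact: e1.
      have [jk'|kj] := ltnP j k; first by rewrite ipC IHn // conjc0.
      by apply: IHn => //; rewrite ltn_neqAle eq_sym jk.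
    rewrite mulr_natr mulrb; over.
  by rewrite -big_nat -big_mkcond /= big_nat1_eq kn subrr mulr0.
move=> j k; have [->|jk] := eqVneq j k; first exact: e1.
have [jk'|kj] := ltnP j k; first by rewrite ipC e0 // conjc0.
by apply: e0; rewrite ltn_neqAle eq_sym jk.
Qed.

End independent.

(** * Completeness, orthonormal expansions and Riesz bases *)

Definition complete_seq v := forall x, (forall k, ip x (v k) = 0) -> x = 0.

Lemma complete_seq_span v w : complete_seq v ->
  (forall k, partial_span w k.+1 (v k)) -> complete_seq w.
Proof.
move=> vc vw x x0; apply: vc => k; have [c ->] := vw k.
rewrite linear_sumr big1 // => j _.
by rewrite linearZr_LR /= x0 mulr0.
Qed.

(** The difference of the two sides has all its coefficients equal to zero. *)
Lemma orthonormal_expansion e x : orthonormal_seq e -> complete_seq e ->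
  synthesis e (fun k => ip x (e k)) = x.
Proof.
move=> eo ec; apply/eqP; rewrite -subr_eq0; apply/eqP; apply: ec => k.
rewrite linearBl /= orthonormal_synthesis ?subrr //.
exact: analysis_l2 (orthonormal_bessel eo).
Qed.

Lemma complete_orthonormal_basis e : orthonormal_seq e -> complete_seq e ->
  orthonormal_basis ip e.
Proof.
move=> eo ec; split=> // O [x Ox] Oopen.
have eb := orthonormal_bessel eo.
have := synthesis_cvg ltr01 eb (analysis_l2 x eb).
(* Density: the partial sums of the expansion of x eventually enter the neighbourhood [O] of x. *)
rewrite orthonormal_expansion // => /(_ O).
case; first exact: open_nbhs_nbhs.
move=> n _ /(_ n (leqnn n)) /= On.
exists (series (fun k => ip x (e k) *: e k) n); split => //.
by exists n, (fun k => ip x (e k)); rewrite /series /= big_mkord.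
Qed.

Lemma riesz_basis_synthesis f B : 0 < B -> bessel f B -> complete_seq f ->
  (forall c, l2 c -> synthesis f c = 0 -> c = fun=> 0) ->
  (forall y, exists2 c, l2 c & synthesis f c = y) ->
  riesz_basis ip f.
Proof.
move=> B0 fb fc f_inj f_surj.
have f_free : linearly_independent f.
  (* Extension by zero makes the finite relation an [l2] sequence, to which injectivity of the
     synthesis applies. *)
  move=> n c c0 k kn; pose d j := if (j < n)%N then c j else 0.
  have dn j : (n <= j)%N -> d j = 0 by rewrite /d ltnNge => ->.
  suff /(congr1 (@^~ k)) : d = (fun=> 0) by rewrite /d kn.
  apply: f_inj; first exact: l2_finite dn.
  rewrite (synthesis_finite _ dn) -[RHS]c0; apply: eq_big_nat => j /andP[_ jn].
  by rewrite /d jn.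
pose e := gram_schmidt f.
have eo : orthonormal_seq e := gram_schmidt_orthonormal f_free.
have ec : complete_seq e := complete_seq_span fc (gram_schmidt_decomp f_free).
have eb := orthonormal_bessel eo.
pose u x := synthesis f (fun k => ip x (e k)).
have u_lin : linear u.
  move=> a x y; rewrite /u -(synthesis_linear _ B0 fb);
    try exact: analysis_l2 eb.
  by congr synthesis; apply/funext => k; rewrite linearPl.
pose U : {linear H -> H} :=
  HB.pack u (GRing.isLinear.Build R[i] H H *:%R u u_lin).
have u_inj x : u x = 0 -> x = 0.
  move=> /(f_inj _ (analysis_l2 x eb)) x0; apply: ec => k.
  by move/(congr1 (@^~ k)): x0.
exists e, U; split.
- exact: complete_orthonormal_basis.
- exists (Num.sqrt B) => x; rewrite -[rnorm x in leRHS]ger0_norm ?rnorm_ge0 //.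
  rewrite -sqrtr_sqr -sqrtrM ?(ltW B0) //.
  apply: (synthesis_bounded B0 fb) => n.
  by apply: le_trans (eb x n) _; rewrite mul1r.
(* The inverse of [U] sends y = T_f c to the vector with coefficients c in the basis [e]. *)
- pose w y : H := synthesis e (s2val (cid2 (f_surj y))).
  have uw y : u (w y) = y.
    rewrite /w; case: cid2 => c /= cl cy; rewrite -[RHS]cy /u.
    by congr synthesis; apply/funext => k; exact: orthonormal_synthesis.
  exists w => // x; apply/eqP; rewrite -subr_eq0; apply/eqP/u_inj.
  by rewrite [u _](linearB U) /= uw subrr.
(* The coefficients of [e k] form the k-th unit sequence, so only the last term of the sum up to k +
   1 survives. *)
- move=> k; rewrite /= /u (@synthesis_finite _ _ k.+1) => [|j kj].
    rewrite big_nat_recr //= eo eqxx scale1r big_nat.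
    rewrite big1 ?add0r // => j /andP[_ jk].
    by rewrite eo gtn_eqF // scale0r.
  by rewrite eo ltn_eqF.
Qed.

(** * Frames and the cross-Gram operator *)

(** If all coefficients of x vanish, the lower bound reads A |x|^2 <= 0; the upper bound gives the
    Bessel property. *)
Lemma frame_bessel f : frame ip f ->
  complete_seq f /\ exists2 B, 0 < B & bessel f B.
Proof.
move=> [A [B [A0 B0 AB]]]; split => [x x0|].
  have [+ _] := AB x; rewrite eseries0 => [|k _ _]; last first.
    by rewrite x0 rnorm0 expr0n.
  rewrite lee_fin pmulr_rle0 // => x2.
  by apply/eqP; rewrite -rnorm_eq0 -sqrf_eq0 eq_le x2 sqr_ge0.
exists B => // x n; have [_ /nneseries_le] := AB x; apply=> k.
exact: sqr_ge0.
Qed.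

Lemma cross_gram_invertible_riesz f g : frame ip f -> frame ip g ->
  l2_invertible (cross_gram ip f g) -> riesz_basis ip f.
Proof.
move=> /frame_bessel[fc [B B0 fb]] /frame_bessel[gc [B' _ gb]].
move=> [_ [S [Sl2 SG GS _]]].
have l20 : l2 (fun=> 0 : R[i]) by exact: (l2_finite (n := 0)).
apply: (riesz_basis_synthesis B0 fb fc) => [c cl c0|y].
  (* [S] recovers c and 0 from their images under G, and these agree because G c depends on c only
     through T_f c. *)
  rewrite -(SG _ cl) -[RHS](SG _ l20); congr S; apply/funext => j.
  rewrite /cross_gram -[limn _]/(synthesis f c).
  rewrite -[limn _]/(synthesis f (fun=> 0)).
  by rewrite c0 (@synthesis_finite _ _ 0) // big_geq.
have yl := analysis_l2 y gb; exists (S (fun j => ip y (g j))); first exact: Sl2.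
apply/eqP; rewrite -subr_eq0; apply/eqP; apply: gc => j.
rewrite linearBl /=; apply/eqP; rewrite subr_eq0.
by apply/eqP/(congr1 (@^~ j) (GS _ yl)).
Qed.

End bessel_sequences.

Theorem corollary2p9 (R : realType) (H : completeNormedModType R[i])
    (ip : {dot H for (@conjc R)})
    (ip_norm : forall x : H, `|x| ^+ 2 = ip x x)
    (f g : nat -> H)
    (f_frame : frame ip f) (g_frame : frame ip g)
    (f_nriesz : ~ riesz_basis ip f) (g_nriesz : ~ riesz_basis ip g) :
  ~ l2_invertible (cross_gram ip f g).
Proof.
by move=> /(cross_gram_invertible_riesz ip_norm f_frame g_frame).
Qed.
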